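(* For any group $G$ and any commutative ring $R$, there are inequalities (in $\mathbb N\cup\{\infty\}$) $$\underline{\mathrm{hd}}_RG\leq \mathrm{sfli}RG\leq \underline{\mathrm{hd}}_RG+\mathrm{wgldim}R.$$
   Context: $RG$ is the group ring; modules are left modules unless stated otherwise. For a ring $\Lambda$, $\mathrm{sfli}\Lambda$ is the supremum of the flat dimensions of injective left $\Lambda$-modules. $\mathrm{wgldim}R$ is the weak global dimension of $R$. The generalized homological dimension of $G$ over $R$ is $\underline{\mathrm{hd}}_RG=\sup\{i\in\mathbb N\mid \mathrm{Tor}^{RG}_i(I,M)\neq0$ for some $RG$-module $M$ that is flat as an $R$-module and some injective right $RG$-module $I\}$. *)

(* Defs.v *)
From HB Require Import structures.
From mathcomp Require Import all_boot all_algebra generic_quotient ring_quotient.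
From mathcomp Require Import finmap.
From mathcomp Require Import boolp.
From mathcomp.multinomials Require Import monalg.

Set Implicit Arguments.
Unset Strict Implicit.
Unset Printing Implicit Defensive.

Import GRing.Theory Quotient.
Local Open Scope ring_scope.
Local Open Scope quotient_scope.

(* Extended natural numbers.  Suprema are least upper bounds in the ordered   *)
(* set nat + {oo}, so the supremum of the empty set is 0 and its infimum oo.  *)

Inductive enat : Type := EFin of nat | EInfty.

Definition enat_le (x y : enat) : bool :=
  match x, y with
  | _, EInfty => true
  | EInfty, EFin _ => false
  | EFin m, EFin n => (m <= n)%N
  end.

Definition enat_add (x y : enat) : enat :=
  match x, y with
  | EFin m, EFin n => EFin (m + n)
  | _, _ => EInfty
  end.

Definition enat_ubound (S : enat -> Prop) (n : nat) : bool :=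
  `[< forall x, S x -> enat_le x (EFin n) >].

Definition enat_sup (S : enat -> Prop) : enat :=
  if pselect (exists n, enat_ubound S n) is left ex then EFin (ex_minn ex)
  else EInfty.

Definition nat_inf (P : nat -> Prop) : enat :=
  if pselect (exists n, `[< P n >]) is left ex then EFin (ex_minn ex)
  else EInfty.

Lemma enat_supP (S : enat -> Prop) (y : enat) :
  enat_le (enat_sup S) y <-> forall x, S x -> enat_le x y.
Proof.
rewrite /enat_sup; case: pselect => [ex|nex].
  case: ex_minnP => m /asboolP mub mle; split=> [le_my x Sx|].
    by have := mub x Sx; case: x {Sx} => [a|] //; case: y le_my => [b|] //=;
      move=> /[swap]; apply: leq_trans.
  by case: y => [b|] // Sb; apply: mle; apply/asboolP.
split; first by case: y => // _ [].
by case: y => // n Sn; case: nex; exists n; apply/asboolP.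
Qed.

Lemma nat_infP (P : nat -> Prop) (n : nat) :
  enat_le (nat_inf P) (EFin n) <-> exists2 m, P m & (m <= n)%N.
Proof.
rewrite /nat_inf; case: pselect => [ex|nex].
  case: ex_minnP => m /asboolP Pm mle; split=> [le_mn|[k Pk le_kn]].
    by exists m.
  by apply: leq_trans le_kn; apply: mle; apply/asboolP.
by split=> // -[m Pm _]; case: nex; exists m; apply/asboolP.
Qed.

(* In the library, the finitely supported functions {malg A[K]} form a module *)
(* only when A is nontrivial, and a ring only when moreover the unit is the   *)
(* sole invertible element of the monoid K.  The aliases freemod and grpring  *)
(* below carry the structures without these restrictions.                     *)

Section FreeModule.
Variables (A : pzRingType) (K : choiceType).

Definition freemod : Type := {malg A[K]}.

HB.instance Definition _ := GRing.Zmodule.on freemod.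

Definition fm_scale (c : A) (g : freemod) : freemod :=
  [malg k in msupp g => c * g@_k].

Lemma fm_scaleE c g k : (fm_scale c g)@_k = c * g@_k.
Proof. by rewrite mcoeffE; case: msuppP; rewrite ?mulr0. Qed.

Lemma fm_scaleA c1 c2 g : fm_scale c1 (fm_scale c2 g) = fm_scale (c1 * c2) g.
Proof. by apply/malgP=> k; rewrite !fm_scaleE mulrA. Qed.

Lemma fm_scale1 : left_id 1 fm_scale.
Proof. by move=> g; apply/malgP=> k; rewrite fm_scaleE mul1r. Qed.

Lemma fm_scaleDr : right_distributive fm_scale +%R.
Proof.
by move=> c g h; apply/malgP=> k; rewrite mcoeffD !fm_scaleE mcoeffD mulrDr.
Qed.

Lemma fm_scaleDl g : {morph fm_scale^~ g : c1 c2 / c1 + c2}.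
Proof.
by move=> c1 c2; apply/malgP=> k; rewrite mcoeffD !fm_scaleE mulrDl.
Qed.

HB.instance Definition _ := GRing.Zmodule_isLmodule.Build A freemod
  fm_scaleA fm_scale1 fm_scaleDr fm_scaleDl.

End FreeModule.

Section LinearExtension.
Variables (A V : zmodType) (K : choiceType).
Variable (h : K -> {additive A -> V}).

Definition malg_lift (g : {malg A[K]}) : V := \sum_(k <- msupp g) h k g@_k.

Lemma malg_liftEw (d : {fset K}) g : (msupp g `<=` d)%fset ->
  malg_lift g = \sum_(k <- d) h k g@_k.
Proof.
move=> le; rewrite [LHS](big_fset_incl _ le) => //= x xd /mcoeff_outdom ->.
by rewrite raddf0.
Qed.

Lemma malg_lift_is_zmod_morphism : zmod_morphism malg_lift.
Proof.
move=> g1 g2; set d := (msupp g1 `|` msupp g2)%fset.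
rewrite (@malg_liftEw d) ?(@malg_liftEw d g1) ?(@malg_liftEw d g2)
  ?fsubsetUl ?fsubsetUr ?msuppB_le //.
by rewrite -sumrB; apply: eq_bigr => k _; rewrite !raddfB.
Qed.

HB.instance Definition _ :=
  GRing.isZmodMorphism.Build {malg A[K]} V malg_lift malg_lift_is_zmod_morphism.

Lemma malg_liftU a k : malg_lift << a *g k >> = h k a.
Proof. by rewrite (malg_liftEw msuppU_le) big_seq_fset1 mcoeffUU. Qed.

End LinearExtension.

(* The evaluation map A^(V) -> V sending the basis element of v to v.         *)
Section Evaluation.
Variables (A : pzRingType) (V : lmodType A).

Definition scale_fun (v : V) (a : A) : V := a *: v.

Fact scale_fun_is_zmod_morphism (v : V) : zmod_morphism (scale_fun v).
Proof. by move=> a b; rewrite /scale_fun scalerBl. Qed.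

HB.instance Definition _ v :=
  GRing.isZmodMorphism.Build A V (scale_fun v) (scale_fun_is_zmod_morphism v).

Definition fm_eval : freemod A V -> V := malg_lift (fun v => scale_fun v).

Lemma fm_eval_is_linear : linear fm_eval.
Proof.
move=> c g h; rewrite /fm_eval [LHS]raddfD /=; congr (_ + _).
have le : (msupp (c *: g : freemod A V) `<=` msupp g)%fset.
  apply/fsubsetP=> k; rewrite -!mcoeff_neq0 fm_scaleE.
  by apply: contra_neq => ->; rewrite mulr0.
rewrite (malg_liftEw _ le) /malg_lift scaler_sumr; apply: eq_bigr => k _.
by rewrite fm_scaleE /= /scale_fun scalerA.
Qed.

HB.instance Definition _ :=
  GRing.isLinear.Build A (freemod A V) V _ fm_eval fm_eval_is_linear.

End Evaluation.

Section GroupRing.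
Variables (R : pzRingType) (G : groupType).

Definition grpring : Type := {malg R[G]}.

HB.instance Definition _ := GRing.Zmodule.on grpring.

Definition gr_one : grpring := << 1 *g (1%g : G) >>.

Definition gr_mul (x y : grpring) : grpring :=
  \sum_(g <- msupp x) \sum_(h <- msupp y) << x@_g * y@_h *g (g * h)%g >>.

Lemma gr_mulEw (d1 d2 : {fset G}) (x y : grpring) :
  (msupp x `<=` d1)%fset -> (msupp y `<=` d2)%fset ->
  gr_mul x y =
    \sum_(g <- d1) \sum_(h <- d2) << x@_g * y@_h *g (g * h)%g >>.
Proof.
move=> le1 le2; rewrite /gr_mul (big_fset_incl _ le1) /=.
  apply: eq_bigr => g _; apply/big_fset_incl => // h _ /mcoeff_outdom ->.
  by rewrite mulr0 monalgU0.
move=> g _ /mcoeff_outdom xg.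
by rewrite big1 => // h _; rewrite xg mul0r monalgU0.
Qed.

Lemma gr_mulUU a b g h :
  gr_mul << a *g g >> << b *g h >> = << a * b *g (g * h)%g >>.
Proof. by rewrite (gr_mulEw msuppU_le msuppU_le) !big_seq_fset1 !mcoeffUU. Qed.

Lemma gr_mulDl : left_distributive gr_mul +%R.
Proof.
move=> x y z; set d := (msupp x `|` msupp y)%fset.
rewrite (@gr_mulEw d (msupp z)) ?msuppD_le //.
rewrite (@gr_mulEw d (msupp z) x) ?fsubsetUl //.
rewrite (@gr_mulEw d (msupp z) y) ?fsubsetUr //.
rewrite -big_split; apply: eq_bigr => g _; rewrite -big_split.
by apply: eq_bigr => h _; rewrite mcoeffD mulrDl monalgUD.
Qed.

Lemma gr_mulDr : right_distributive gr_mul +%R.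
Proof.
move=> z x y; set d := (msupp x `|` msupp y)%fset.
rewrite (@gr_mulEw (msupp z) d) ?msuppD_le //.
rewrite (@gr_mulEw (msupp z) d z x) ?fsubsetUl //.
rewrite (@gr_mulEw (msupp z) d z y) ?fsubsetUr //.
rewrite -big_split; apply: eq_bigr => g _; rewrite -big_split.
by apply: eq_bigr => h _; rewrite mcoeffD mulrDr monalgUD.
Qed.

Lemma gr_mul0 : left_zero 0 gr_mul.
Proof. by move=> x; apply: (addIr (gr_mul 0 x)); rewrite -gr_mulDl !add0r. Qed.

Lemma gr_mulr0 : right_zero 0 gr_mul.
Proof. by move=> x; apply: (addIr (gr_mul x 0)); rewrite -gr_mulDr !add0r. Qed.

Lemma gr_ind (P : grpring -> Prop) :
  P 0 -> (forall x y, P x -> P y -> P (x + y)) ->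
  (forall a g, P << a *g g >>) -> forall x, P x.
Proof. by move=> P0 PD PU x; rewrite [x]monalgE; apply: big_ind. Qed.

Lemma gr_mulA : associative gr_mul.
Proof.
move=> x y z; elim/gr_ind: x => [|x1 x2|a g]; first by rewrite !gr_mul0.
  by rewrite !gr_mulDl => -> ->.
elim/gr_ind: y => [|y1 y2|b h]; first by rewrite !(gr_mul0, gr_mulr0).
  by rewrite !(gr_mulDl, gr_mulDr) => -> ->.
elim/gr_ind: z => [|z1 z2|c k]; first by rewrite !gr_mulr0.
  by rewrite !gr_mulDr => -> ->.
by rewrite !gr_mulUU mulrA mulgA.
Qed.

Lemma gr_mul1 : left_id gr_one gr_mul.
Proof.
elim/gr_ind=> [|x y|a g]; first by rewrite gr_mulr0.
  by rewrite gr_mulDr => -> ->.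
by rewrite gr_mulUU mul1r mul1g.
Qed.

Lemma gr_mulr1 : right_id gr_one gr_mul.
Proof.
elim/gr_ind=> [|x y|a g]; first by rewrite gr_mul0.
  by rewrite gr_mulDl => -> ->.
by rewrite gr_mulUU mulr1 mulg1.
Qed.

HB.instance Definition _ := GRing.Zmodule_isPzRing.Build grpring
  gr_mulA gr_mul1 gr_mulr1 gr_mulDl gr_mulDr.

Definition gr_const (r : R) : grpring := << r *g (1%g : G) >>.

Fact gr_const_is_zmod_morphism : zmod_morphism gr_const.
Proof. by move=> r s; rewrite /gr_const monalgUB. Qed.

Fact gr_const_is_monoid_morphism : monoid_morphism gr_const.
Proof. by split=> // r s; rewrite /gr_const [RHS]gr_mulUU mulg1. Qed.

HB.instance Definition _ :=
  GRing.isZmodMorphism.Build R grpring gr_const gr_const_is_zmod_morphism.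
HB.instance Definition _ :=
  GRing.isMonoidMorphism.Build R grpring gr_const gr_const_is_monoid_morphism.

End GroupRing.

(* V viewed as an A-module by restriction of scalars along f. *)
Definition restr (A B : pzRingType) (f : {rmorphism A -> B}) (V : lmodType B) :
  Type := V.

Section Restriction.
Variables (A B : pzRingType) (f : {rmorphism A -> B}) (V : lmodType B).

HB.instance Definition _ := GRing.Zmodule.on (restr f V).

Definition restr_scale (a : A) (v : restr f V) : restr f V := f a *: (v : V).

Fact restr_scaleA a b v :
  restr_scale a (restr_scale b v) = restr_scale (a * b) v.
Proof. by rewrite /restr_scale scalerA rmorphM. Qed.

Fact restr_scale1 : left_id 1 restr_scale.
Proof. by move=> v; rewrite /restr_scale rmorph1 scale1r. Qed.

Fact restr_scaleDr : right_distributive restr_scale +%R.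
Proof. by move=> a u v; rewrite /restr_scale scalerDr. Qed.

Fact restr_scaleDl v : {morph restr_scale^~ v : a b / a + b}.
Proof. by move=> a b; rewrite /restr_scale rmorphD scalerDl. Qed.

HB.instance Definition _ := GRing.Zmodule_isLmodule.Build A (restr f V)
  restr_scaleA restr_scale1 restr_scaleDr restr_scaleDl.

End Restriction.

Definition kerp (U V : zmodType) (f : U -> V) : {pred U} := fun x => f x == 0.

Section KerZmod.
Variables (U V : zmodType) (f : {additive U -> V}).

Fact kerp_zmod_closed : zmod_closed (kerp f).
Proof.
split=> [|x y]; rewrite !unfold_in ?raddf0 // => /eqP fx /eqP fy.
by rewrite raddfB fx fy subrr.
Qed.

HB.instance Definition _ := GRing.isZmodClosed.Build U (kerp f) kerp_zmod_closed.

Definition kermod : Type := {x : U | x \in kerp f}.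
HB.instance Definition _ := SubChoice.on kermod.
HB.instance Definition _ := [SubChoice_isSubZmodule of kermod by <:].

End KerZmod.

Section KerLmod.
Variables (A : pzRingType) (U V : lmodType A) (f : {linear U -> V}).

Fact kerp_scaler_closed : GRing.scaler_closed (kerp f).
Proof. by move=> a x; rewrite !unfold_in linearZ => /eqP -> /=; rewrite scaler0. Qed.

HB.instance Definition _ := GRing.isScaleClosed.Build A U (kerp f) kerp_scaler_closed.
HB.instance Definition _ := [SubZmodule_isSubLmodule of kermod f by <:].
End KerLmod.

(* ker g / im f, for U --f--> V --g--> W with g o f = 0. *)
Section Homology.
Variables (U V W : zmodType) (f : {additive U -> V}) (g : {additive V -> W}).

Definition imp : {pred kermod g} := fun x => `[< exists u, f u = val x >].

Fact imp_zmod_closed : zmod_closed imp.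
Proof.
split=> [|x y]; rewrite !unfold_in.
  by apply/asboolP; exists 0; rewrite raddf0.
move=> /asboolP[u fu] /asboolP[v fv]; apply/asboolP.
by exists (u - v); rewrite raddfB fu fv.
Qed.

HB.instance Definition _ := GRing.isZmodClosed.Build (kermod g) imp imp_zmod_closed.

Definition homology : zmodType := {quot (imp : zmodClosed (kermod g))}.

End Homology.

(* A right A-module is a left module over the converse ring A^c; for          *)
(* a : A^c, the vector a *: n is then the product n.a.                        *)
Notation rmodType A := (lmodType A^c).

(* The tensor product over A of a right module N and a left module M: the     *)
(* quotient of the free abelian group on N * M by the bilinearity and balance *)
(* relations.                                                                 *)
Section Tensor.
Variables (A : pzRingType) (N : rmodType A) (M : lmodType A).

Definition pretensor : zmodType := {malg (N * M)%type}.

Inductive tensor_rel : pretensor -> Prop :=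
| TensorRel0 : tensor_rel 0
| TensorRelB x y : tensor_rel x -> tensor_rel y -> tensor_rel (x - y)
| TensorRelDl n1 n2 m :
    tensor_rel (<< (n1 + n2, m) >> - << (n1, m) >> - << (n2, m) >>)
| TensorRelDr n m1 m2 :
    tensor_rel (<< (n, m1 + m2) >> - << (n, m1) >> - << (n, m2) >>)
| TensorRelA n (a : A) m :
    tensor_rel (<< ((a : A^c) *: n, m) >> - << (n, a *: m) >>).

Definition tensor_pred : {pred pretensor} := fun x => `[< tensor_rel x >].

Fact tensor_pred_zmod_closed : zmod_closed tensor_pred.
Proof.
split=> [|x y]; first by apply/asboolP; constructor.
by move=> /asboolP Rx /asboolP Ry; apply/asboolP; constructor.
Qed.

HB.instance Definition _ :=
  GRing.isZmodClosed.Build pretensor tensor_pred tensor_pred_zmod_closed.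

Definition tensor : zmodType := {quot (tensor_pred : zmodClosed pretensor)}.

Definition tensor_pi (x : pretensor) : tensor :=
  \pi_({quot (tensor_pred : zmodClosed pretensor)}) x.

Fact tensor_pi_is_zmod_morphism : zmod_morphism tensor_pi.
Proof. exact: raddfB. Qed.

HB.instance Definition _ :=
  GRing.isZmodMorphism.Build pretensor tensor tensor_pi tensor_pi_is_zmod_morphism.

Definition tensor_repr (t : tensor) : pretensor :=
  repr (t : {quot (tensor_pred : zmodClosed pretensor)}).

Lemma tensor_reprK : cancel tensor_repr tensor_pi.
Proof. exact: reprK. Qed.

Lemma tensor_pi_eq x y : tensor_pi x = tensor_pi y <-> tensor_rel (x - y).
Proof.
split=> [/eqP|Rxy]; first by rewrite -idealrBE => /asboolP.
by apply/eqP; rewrite -idealrBE; apply/asboolP.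
Qed.

Definition tens (n : N) (m : M) : tensor := tensor_pi << (n, m) >>.

End Tensor.

Section TensorMap.
Variables (A : pzRingType) (N N' : rmodType A) (M M' : lmodType A).
Variables (f : {linear N -> N'}) (g : {linear M -> M'}).

Definition tens_fun (k : N * M) (z : int) : tensor N' M' :=
  tens (f k.1) (g k.2) *~ z.

Fact tens_fun_is_zmod_morphism k : zmod_morphism (tens_fun k).
Proof. by move=> y z; rewrite /tens_fun mulrzBr. Qed.

HB.instance Definition _ k :=
  GRing.isZmodMorphism.Build int (tensor N' M') (tens_fun k)
    (tens_fun_is_zmod_morphism k).

Definition pretensor_map : {additive pretensor N M -> tensor N' M'} :=
  malg_lift (fun k => tens_fun k).

Definition tensor_map (t : tensor N M) : tensor N' M' :=
  pretensor_map (tensor_repr t).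

Lemma pretensor_mapU n m : pretensor_map << (n, m) >> = tens (f n) (g m).
Proof. by rewrite /pretensor_map /= malg_liftU. Qed.

Lemma pretensor_map_rel x : tensor_rel x -> pretensor_map x = 0.
Proof.
elim=> [|y z _ y0 _ z0|n1 n2 m|n m1 m2|n a m]; rewrite ?raddf0 //.
- by rewrite raddfB y0 z0 subrr.
- rewrite !raddfB !pretensor_mapU raddfD /tens -!raddfB -(raddf0 (@tensor_pi _ _ _)).
  by apply/tensor_pi_eq; rewrite subr0; apply: TensorRelDl.
- rewrite !raddfB !pretensor_mapU raddfD /tens -!raddfB -(raddf0 (@tensor_pi _ _ _)).
  by apply/tensor_pi_eq; rewrite subr0; apply: TensorRelDr.
rewrite raddfB !pretensor_mapU !linearZ /tens -raddfB -(raddf0 (@tensor_pi _ _ _)).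
by apply/tensor_pi_eq; rewrite subr0; apply: TensorRelA.
Qed.

Lemma tensor_map_pi x : tensor_map (tensor_pi x) = pretensor_map x.
Proof.
apply/eqP; rewrite -subr_eq0 -raddfB; apply/eqP/pretensor_map_rel.
by apply/tensor_pi_eq; rewrite tensor_reprK.
Qed.

Lemma tensor_map_tens n m : tensor_map (tens n m) = tens (f n) (g m).
Proof. by rewrite tensor_map_pi pretensor_mapU. Qed.

Fact tensor_map_is_zmod_morphism : zmod_morphism tensor_map.
Proof.
move=> s t; rewrite -[s]tensor_reprK -[t]tensor_reprK -raddfB.
by rewrite !tensor_map_pi raddfB.
Qed.

HB.instance Definition _ :=
  GRing.isZmodMorphism.Build (tensor N M) (tensor N' M') tensor_map
    tensor_map_is_zmod_morphism.

End TensorMap.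

(* Tor i N M is the i-th homology of N (x) F, where F is the canonical free   *)
(* resolution of M: F i is the free module on the underlying set of the i-th  *)
(* syzygy syz M i, with syz M 0 = M, and syz M i.+1 is the kernel of the      *)
(* evaluation map F i -> syz M i.                                             *)
Section Tor.
Variables (A : pzRingType).

Fixpoint syz (M : lmodType A) (i : nat) : lmodType A :=
  if i is j.+1 then kermod (@fm_eval A (syz M j)) else M.

Definition free_res (M : lmodType A) (i : nat) : lmodType A := freemod A (syz M i).

Definition ker_incl (U V : lmodType A) (f : {linear U -> V}) :
  {linear kermod f -> U} := val.

Definition res_diff (M : lmodType A) (i : nat) : {linear free_res M i.+1 -> free_res M i} :=
  ker_incl (@fm_eval A (syz M i)) \o @fm_eval A (syz M i.+1).

Definition tor_diff (N : rmodType A) (M : lmodType A) (i : nat) :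
    {additive tensor N (free_res M i.+1) -> tensor N (free_res M i)} :=
  tensor_map idfun (res_diff M i).

Definition Tor (i : nat) (N : rmodType A) (M : lmodType A) : zmodType :=
  if i is j.+1 then homology (tor_diff N M j.+1) (tor_diff N M j)
  else homology (tor_diff N M 0)
         (\0 : {additive tensor N (free_res M 0) -> tensor N (free_res M 0)}).

End Tor.

Section HomologicalDimensions.
Variable A : pzRingType.

Definition injective_module (I : lmodType A) : Prop :=
  forall (U V : lmodType A) (j : {linear U -> V}) (f : {linear U -> I}),
    injective j -> exists g : {linear V -> I}, forall u, g (j u) = f u.

Definition flat_module (M : lmodType A) : Prop :=
  forall (U V : rmodType A) (j : {linear U -> V}),
    injective j -> injective (tensor_map j (idfun : {linear M -> M})).

(* There is an exact sequence 0 -> F n -> ... -> F 0 -> M -> 0 with all F k   *)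
(* flat.                                                                      *)
Definition flat_resolution_le (M : lmodType A) (n : nat) : Prop :=
  exists (F : nat -> lmodType A) (d : forall k, {linear F k.+1 -> F k})
         (e : {linear F 0 -> M}),
    [/\ forall k, flat_module (F k),
        forall k, (n < k)%N -> forall x : F k, x = 0,
        forall m, exists x, e x = m,
        forall x, e x = 0 <-> exists y, d 0 y = x &
        forall k x, d k x = 0 <-> exists y, d k.+1 y = x].

Definition flat_dim (M : lmodType A) : enat := nat_inf (flat_resolution_le M).

Definition sfli : enat :=
  enat_sup (fun x => exists2 I : lmodType A, injective_module I & x = flat_dim I).

Definition wgldim : enat :=
  enat_sup (fun x => exists M : lmodType A, x = flat_dim M).

End HomologicalDimensions.

Definition ghd (R : comPzRingType) (G : groupType) : enat :=
  enat_sup (fun x => exists (i : nat) (I : rmodType (grpring R G))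
                            (M : lmodType (grpring R G)),
    [/\ x = EFin i, injective_module I,
        flat_module (restr (@gr_const R G) M) &
        exists t : Tor i I M, t != 0]).

(* Main.v *)
(* Inversion in G makes a left RG-module out of a right one, so the tensor      *)
(* product over RG is symmetric, right modules can be traded for left ones, and *)
(* Tor is balanced.  Dimension shifting along 0 -> K -> F -> L -> 0 with F flat *)
(* then shows that L has a flat resolution of length n if and only if           *)
(* Tor_i(L, X) = 0 for all X and all i > n; the first inequality follows at     *)
(* once.  For the second one, let m = wgldim R.  Free RG-modules are free over  *)
(* R, so the m-th syzygy Y of any RG-module X is R-flat, and for I injective    *)
(* Tor_(i + m)(I, X) = Tor_i(I, Y) vanishes as soon as i > hd_R G.              *)
(* Tor is handled through kernels: Tor_(j + 1)(N, X) vanishes exactly when N    *)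
(* (x) - is injective on the inclusion of the (j + 1)-st syzygy of X in F_j.    *)
Require Import Defs.
From mathcomp Require Import all_boot all_algebra.
From HB Require Import structures.
From mathcomp Require Import generic_quotient ring_quotient finmap boolp.
From mathcomp.multinomials Require Import monalg.

Set Implicit Arguments.
Unset Strict Implicit.
Unset Printing Implicit Defensive.

Import GRing.Theory Quotient.
Local Open Scope ring_scope.
Local Open Scope quotient_scope.

(** Both inequalities are read off from the vanishing of Tor. Over a ring with an anti-involution,
    [flat_resolutionP] shows that [L] has a flat resolution of length [n] exactly when Tor_i(L, X) =
    0 for all [X] and all i > n ([tor_vanish]). The induction on [n] replaces [L] by the kernel of a
    surjection from a flat module ([tor_vanish_shift], which rests on [tor1_shift]) and starts at
    [tor_vanish0_flat]. [Tor_eq0] ties this condition to the homology groups [Tor], and [gr_inv] is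
    the anti-involution of the group ring.

    If Tor_i(I, M) is nonzero with [I] injective, then i is at most the flat dimension of [I] turned
    into a left module, which is again injective ([restr_injective]). This gives [ghd_le_sfli].
    Conversely, let m be the weak global dimension of [R]. The canonical resolution of [X] stays
    flat over [R], so its m-th syzygy Y is flat over [R] ([restr_syz_flat]). For i > 0, Tor_(i +
    m)(I, X) is Tor_i(I, Y), which vanishes as soon as i exceeds [ghd R G]. This gives
    [sfli_le_ghd_wgldim]. *)

(** * Tensor products: bilinearity, induction, universal property, functoriality *)

Section TensorBasics.
Variables (A : pzRingType) (N : rmodType A) (M : lmodType A).

Lemma tensDl (n1 n2 : N) (m : M) : tens (n1 + n2) m = tens n1 m + tens n2 m.
Proof.
apply/eqP; rewrite -subr_eq0 opprD addrA /tens -!raddfB.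
rewrite -(raddf0 (@tensor_pi _ N M)); apply/eqP/tensor_pi_eq.
by rewrite subr0; apply: TensorRelDl.
Qed.

Lemma tensDr (n : N) (m1 m2 : M) : tens n (m1 + m2) = tens n m1 + tens n m2.
Proof.
apply/eqP; rewrite -subr_eq0 opprD addrA /tens -!raddfB.
rewrite -(raddf0 (@tensor_pi _ N M)); apply/eqP/tensor_pi_eq.
by rewrite subr0; apply: TensorRelDr.
Qed.

Lemma tensZ (a : A) (n : N) (m : M) : tens ((a : A^c) *: n) m = tens n (a *: m).
Proof. by apply/tensor_pi_eq; apply: TensorRelA. Qed.

Lemma tens0l (m : M) : tens (0 : N) m = 0.
Proof. by apply: (addrI (tens 0 m)); rewrite -tensDl !addr0. Qed.

Lemma tens0r (n : N) : tens n (0 : M) = 0.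
Proof. by apply: (addrI (tens n 0)); rewrite -tensDr !addr0. Qed.

Lemma tensNl (n : N) (m : M) : tens (- n) m = - tens n m.
Proof. by apply: (addIr (tens n m)); rewrite -tensDl !addNr tens0l. Qed.

Lemma tensBr (n : N) (m1 m2 : M) : tens n (m1 - m2) = tens n m1 - tens n m2.
Proof. by apply: (addIr (tens n m2)); rewrite -tensDr !subrK. Qed.

Lemma pretensor_ind (P : pretensor N M -> Prop) :
  P 0 -> (forall x y, P x -> P y -> P (x + y)) -> (forall x, P x -> P (- x)) ->
  (forall n m, P << (n, m) >>) -> forall x, P x.
Proof.
move=> P0 PD PN PU x; rewrite [x]monalgE; apply: big_ind => // -[n m] _.
(* Coefficients are integers, so a monomial is a natural multiple of a generator or the opposite of
   one. *)
have PM k : P (<< (n, m) >> *+ k).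
  by elim: k => [|k IHk]; rewrite ?mulr0n // mulrS; apply: PD.
case: (x@_(n, m)) => k; first by rewrite -natz monalgUMn.
by rewrite NegzE -natz monalgUN monalgUMn; apply: PN.
Qed.

Lemma tensor_ind (P : tensor N M -> Prop) :
  P 0 -> (forall s t, P s -> P t -> P (s + t)) -> (forall t, P t -> P (- t)) ->
  (forall n m, P (tens n m)) -> forall t, P t.
Proof.
move=> P0 PD PN PU t; rewrite -[t]tensor_reprK.
elim/pretensor_ind: (tensor_repr t) => [|x y Px Py|x Px|n m]; rewrite ?raddf0 //.
- by rewrite raddfD; apply: PD.
- by rewrite raddfN; apply: PN.
exact: PU.
Qed.

Lemma tensor_ext (V : zmodType) (f g : {additive tensor N M -> V}) :
  (forall n m, f (tens n m) = g (tens n m)) -> f =1 g.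
Proof.
move=> fg; elim/tensor_ind=> [|s t fs ft|t ft|n m //]; rewrite ?raddf0 //.
  by rewrite !raddfD fs ft.
by rewrite !raddfN ft.
Qed.

End TensorBasics.

Section Universal.
Variables (A : pzRingType) (N : rmodType A) (M : lmodType A) (V : zmodType).

Lemma pretensor_univ (h : N -> M -> V) : exists f : {additive pretensor N M -> V},
  forall n m, f << (n, m) >> = h n m.
Proof.
pose f0 (k : N * M) (z : int) := h k.1 k.2 *~ z.
have f0B k : zmod_morphism (f0 k) by move=> y z; rewrite /f0 mulrzBr.
pose f1 k : {additive int -> V} :=
  HB.pack (f0 k) (GRing.isZmodMorphism.Build int V (f0 k) (f0B k)).
by exists (malg_lift f1) => n m; rewrite /= malg_liftU.
Qed.

Lemma tensor_univ (h : N -> M -> V) :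
  (forall n1 n2 m, h (n1 + n2) m = h n1 m + h n2 m) ->
  (forall n m1 m2, h n (m1 + m2) = h n m1 + h n m2) ->
  (forall (a : A) n m, h ((a : A^c) *: n) m = h n (a *: m)) ->
  exists f : {additive tensor N M -> V}, forall n m, f (tens n m) = h n m.
Proof.
move=> hDl hDr hA; have [f fE] := pretensor_univ h.
have f0 x : tensor_rel x -> f x = 0.
  elim=> [|y z _ fy _ fz|n1 n2 m|n m1 m2|n a m]; rewrite ?raddf0 //.
  - by rewrite raddfB fy fz subrr.
  - by rewrite !raddfB !fE hDl addrAC addrK subrr.
  - by rewrite !raddfB !fE hDr addrAC addrK subrr.
  by rewrite raddfB !fE hA subrr.
pose g (t : tensor N M) := f (tensor_repr t).
have gE x : g (tensor_pi x) = f x.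
  apply/eqP; rewrite -subr_eq0 -raddfB; apply/eqP/f0.
  by apply/tensor_pi_eq; rewrite tensor_reprK.
have gB : zmod_morphism g.
  move=> s t; rewrite -[s]tensor_reprK -[t]tensor_reprK -raddfB.
  by rewrite !gE raddfB.
exists (HB.pack g (GRing.isZmodMorphism.Build _ _ g gB) : {additive _ -> _}).
by move=> n m; rewrite -fE -gE.
Qed.

End Universal.

Lemma tensor_map_square (A : pzRingType) (N1 N2 N3 N4 : rmodType A)
    (M1 M2 M3 M4 : lmodType A)
    (f : {linear N1 -> N2}) (f' : {linear N2 -> N4})
    (h : {linear N1 -> N3}) (h' : {linear N3 -> N4})
    (g : {linear M1 -> M2}) (g' : {linear M2 -> M4})
    (k : {linear M1 -> M3}) (k' : {linear M3 -> M4}) :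
  (forall n, f' (f n) = h' (h n)) -> (forall m, g' (g m) = k' (k m)) ->
  forall t, tensor_map f' g' (tensor_map f g t) =
            tensor_map h' k' (tensor_map h k t).
Proof.
move=> eqN eqM; apply: (tensor_ext (f := tensor_map f' g' \o tensor_map f g)
  (g := tensor_map h' k' \o tensor_map h k)) => n m /=.
by rewrite !tensor_map_tens eqN eqM.
Qed.

Lemma tensor_map_id (A : pzRingType) (N : rmodType A) (M : lmodType A)
    (f : {linear N -> N}) (g : {linear M -> M}) :
  f =1 id -> g =1 id -> tensor_map f g =1 id.
Proof.
move=> fid gid; apply: (tensor_ext (f := tensor_map f g) (g := idfun)) => n m /=.
by rewrite tensor_map_tens fid gid.
Qed.

Lemma tensor_map_comp (A : pzRingType) (N1 N2 N3 : rmodType A)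
    (M1 M2 M3 : lmodType A)
    (f : {linear N1 -> N2}) (f' : {linear N2 -> N3}) (f'' : {linear N1 -> N3})
    (g : {linear M1 -> M2}) (g' : {linear M2 -> M3}) (g'' : {linear M1 -> M3}) :
  (forall n, f' (f n) = f'' n) -> (forall m, g' (g m) = g'' m) ->
  forall t, tensor_map f' g' (tensor_map f g t) = tensor_map f'' g'' t.
Proof.
move=> eqN eqM t; rewrite (tensor_map_square (h := idfun) (h' := f'')
  (k := idfun) (k' := g'') eqN eqM).
by rewrite [tensor_map idfun idfun t]tensor_map_id.
Qed.

Lemma tensor_map_eq0 (A : pzRingType) (N N' : rmodType A) (M M' : lmodType A)
    (f : {linear N -> N'}) (g : {linear M -> M'}) :
  (forall n, f n = 0) \/ (forall m, g m = 0) -> forall t, tensor_map f g t = 0.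
Proof.
move=> fg0; apply: (tensor_ext (f := tensor_map f g) (g := \0)) => n m /=.
by rewrite tensor_map_tens; case: fg0 => ->; rewrite ?tens0l ?tens0r.
Qed.

Lemma additive_inj (U V : zmodType) (f : {additive U -> V}) :
  (forall u, f u = 0 -> u = 0) -> injective f.
Proof.
move=> f0 u v fuv; apply/eqP; rewrite -subr_eq0; apply/eqP/f0.
by rewrite raddfB fuv subrr.
Qed.

Lemma additive_inj0 (U V : zmodType) (f : {additive U -> V}) :
  injective f -> forall u, f u = 0 -> u = 0.
Proof. by move=> fI u fu; apply: fI; rewrite fu raddf0. Qed.

Definition short_exact (A : pzRingType) (U V W : lmodType A)
    (i : {linear U -> V}) (p : {linear V -> W}) : Prop :=
  [/\ injective i, forall w, exists v, p v = w &
      forall v, p v = 0 <-> exists u, i u = v].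

(** * Right exactness of the tensor product *)

Section RightExactness.
Variables (A : pzRingType) (N : rmodType A) (U V W : lmodType A).
Variables (f : {linear U -> V}) (g : {linear V -> W}).
Hypothesis g_surj : forall w, exists v, g v = w.

Lemma tensor_surj (t : tensor N W) : exists s, tensor_map (idfun : {linear N -> N}) g s = t.
Proof.
elim/tensor_ind: t => [|s t [s' <-] [t' <-]|t [t' <-]|n w].
- by exists 0; rewrite raddf0.
- by exists (s' + t'); rewrite raddfD.
- by exists (- t'); rewrite raddfN.
by have [v <-] := g_surj w; exists (tens n v); rewrite tensor_map_tens.
Qed.

(* A set-theoretic section s of g gives a map (n, w) |-> n (x) s w which is    *)
(* bilinear and balanced modulo the image of N (x) U.                          *)
Lemma tensor_right_exact :
  (forall v, g v = 0 -> exists u, f u = v) ->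
  forall t, tensor_map (idfun : {linear N -> N}) g t = 0 ->
  exists s, tensor_map (idfun : {linear N -> N}) f s = t.
Proof.
move=> fg t; pose im x := exists s, tensor_map (idfun : {linear N -> N}) f s = x.
have imD x y : im x -> im y -> im (x + y).
  by move=> [x' <-] [y' <-]; exists (x' + y'); rewrite raddfD.
have imN x : im x -> im (- x).
  by move=> [x' <-]; exists (- x'); rewrite raddfN.
have im_tens n v : g v = 0 -> im (tens n v).
  by move=> /fg[u <-]; exists (tens n u); rewrite tensor_map_tens.
have [s sK] := choice g_surj.
have [S SE] := pretensor_univ (fun (n : N) (w : W) => tens n (s w)).
have Sim x : tensor_rel x -> im (S x).
  elim=> [|y z _ Sy _ Sz|n1 n2 m|n m1 m2|n a m].
  - by exists 0; rewrite !raddf0.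
  - by rewrite raddfB; apply/imD/imN.
  - by rewrite !raddfB !SE tensDl addrAC addrK subrr; exists 0; rewrite raddf0.
  - by rewrite !raddfB !SE -!tensBr; apply: im_tens; rewrite !linearB !sK addrAC addrK subrr.
  by rewrite raddfB !SE tensZ -tensBr; apply: im_tens; rewrite linearB linearZ !sK subrr.
(* Every [t] agrees, modulo the image, with [S x] for some lift [x] of its image in [tensor N W].
   When that image is 0, [x] is a relation, so [S x] is itself in the image. *)
suff [x [xg xt]] : exists x, tensor_pi x = tensor_map idfun g t /\ im (t - S x).
  move=> gt0; rewrite -[t](subrK (S x)); apply: imD => //; apply: Sim.
  by rewrite -[x]subr0; apply/tensor_pi_eq; rewrite raddf0 xg.
elim/tensor_ind: t => [|t1 t2 [x1 [e1 i1]] [x2 [e2 i2]]|t1 [x1 [e1 i1]]|n v].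
- by exists 0; rewrite !raddf0 addr0; split=> //; exists 0; rewrite raddf0.
- exists (x1 + x2); split; first by rewrite raddfD /= e1 e2 raddfD.
  by rewrite raddfD opprD addrACA; apply: imD.
- exists (- x1); split; first by rewrite [LHS]raddfN /= e1 raddfN.
  by rewrite [S _]raddfN -opprD; apply: imN.
exists << (n, g v) >>; rewrite tensor_map_tens; split=> //.
by rewrite SE -tensBr; apply: im_tens; rewrite linearB sK subrr.
Qed.

End RightExactness.

(** * Anti-involutions and the balance of Tor_1 *)

Section RestrictionMap.
Variables (A B : pzRingType) (f : {rmorphism A -> B}) (U V : lmodType B).
Variable (g : {linear U -> V}).

Definition restr_map (u : restr f U) : restr f V := g u.

Fact restr_map_is_linear : linear restr_map.
Proof. by move=> a u v; rewrite /restr_map [LHS]linearD [g _]linearZ. Qed.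

HB.instance Definition _ := GRing.isLinear.Build A (restr f U) (restr f V) _
  restr_map restr_map_is_linear.

End RestrictionMap.

Arguments restr_map {A B} f {U V} g u.

(* An anti-involution sg of A turns a left module V into the right module      *)
(* [restr sg V], and makes [tensor (restr sg L) K] symmetric in K and L.       *)
Section AntiInvolution.
Variables (A : pzRingType) (sg : {rmorphism A^c -> A}).
Hypothesis sgK : forall a : A, sg (sg a) = a.

Lemma tensor_flip (K L : lmodType A) :
  {f : {additive tensor (restr sg K) L -> tensor (restr sg L) K} |
    forall k l, f (tens k l) = tens (l : restr sg L) (k : K)}.
Proof.
apply: cid; apply: tensor_univ.
- by move=> k1 k2 l; rewrite tensDr.
- by move=> k l1 l2; rewrite tensDl.
move=> a k l; rewrite -[LHS]tensZ; congr tens.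
by rewrite /GRing.scale /= /restr_scale sgK.
Qed.

Definition tflip (K L : lmodType A) := sval (tensor_flip K L).

Lemma tflipE (K L : lmodType A) (k : restr sg K) (l : L) :
  tflip K L (tens k l) = tens (l : restr sg L) (k : K).
Proof. exact: svalP (tensor_flip K L) k l. Qed.

Lemma tflipK (K L : lmodType A) : cancel (tflip K L) (tflip L K).
Proof.
apply: (tensor_ext (f := tflip L K \o tflip K L) (g := idfun)) => k l /=.
by rewrite !tflipE.
Qed.

Definition tmapl (K : lmodType A) (U V : lmodType A) (f : {linear U -> V}) :
    {additive tensor (restr sg U) K -> tensor (restr sg V) K} :=
  tensor_map (restr_map sg f : {linear restr sg U -> restr sg V}) idfun.

Definition tmapr (K : lmodType A) (U V : lmodType A) (f : {linear U -> V}) :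
    {additive tensor (restr sg K) U -> tensor (restr sg K) V} :=
  tensor_map idfun f.

Lemma tflip_mapl (K U V : lmodType A) (f : {linear U -> V}) t :
  tflip V K (tmapl K f t) = tmapr K f (tflip U K t).
Proof.
apply: (tensor_ext (f := tflip V K \o tmapl K f) (g := tmapr K f \o tflip U K)).
by move=> u k /=; rewrite /tmapl /tmapr tensor_map_tens !tflipE tensor_map_tens.
Qed.

Lemma tflip_mapr (K U V : lmodType A) (f : {linear U -> V}) t :
  tflip K V (tmapr K f t) = tmapl K f (tflip K U t).
Proof. by rewrite -[t in LHS]tflipK -tflip_mapl tflipK. Qed.

Lemma tmapl_inj (K U V : lmodType A) (f : {linear U -> V}) :
  injective (tmapr K f) -> injective (tmapl K f).
Proof.
move=> fI s t /(congr1 (tflip V K)); rewrite !tflip_mapl => /fI.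
exact: (can_inj (@tflipK U K)).
Qed.

Lemma tmapr_inj (K U V : lmodType A) (f : {linear U -> V}) :
  injective (tmapl K f) -> injective (tmapr K f).
Proof.
move=> fI s t /(congr1 (tflip K V)); rewrite !tflip_mapr => /fI.
exact: (can_inj (@tflipK K U)).
Qed.

Lemma tmaplr (U V K L : lmodType A) (f : {linear U -> V}) (g : {linear K -> L}) t :
  tmapl L f (tmapr U g t) = tmapr V g (tmapl K f t).
Proof. exact: tensor_map_square. Qed.

Lemma tmapl_exact (K U V W : lmodType A) (i : {linear U -> V}) (p : {linear V -> W}) t :
  short_exact i p -> tmapl K p t = 0 -> exists s, tmapl K i s = t.
Proof.
move=> [_ p_surj ip] /(congr1 (tflip W K)); rewrite raddf0 tflip_mapl => pt0.
have [|s st] := tensor_right_exact (f := i) p_surj _ pt0; first by move=> v /ip.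
by exists (tflip K U s); rewrite -tflip_mapr [tmapr K i s]st tflipK.
Qed.

Lemma tmapr_exact (K U V W : lmodType A) (i : {linear U -> V}) (p : {linear V -> W}) t :
  short_exact i p -> tmapr K p t = 0 -> exists s, tmapr K i s = t.
Proof.
by move=> [_ p_surj ip] /(tensor_right_exact (f := i) p_surj); apply=> v /ip.
Qed.

Lemma flat_tmapl_inj (K U V : lmodType A) (i : {linear U -> V}) :
  flat_module K -> injective i -> injective (tmapl K i).
Proof. by move=> Kflat iI; apply: Kflat. Qed.

Lemma flat_tmapr_inj (K U V : lmodType A) (i : {linear U -> V}) :
  flat_module K -> injective i -> injective (tmapr K i).
Proof. by move=> Kflat iI; apply/tmapr_inj/flat_tmapl_inj. Qed.

Section Balance.
Variables (L1 F L : lmodType A) (i : {linear L1 -> F}) (p : {linear F -> L}).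
Variables (K1 P K : lmodType A) (k : {linear K1 -> P}) (q : {linear P -> K}).
Hypotheses (ip : short_exact i p) (kq : short_exact k q).

(* Both conditions say that Tor_1(L, K) = 0; the proof is a diagram chase.     *)
Lemma tor1_balance : flat_module P ->
  injective (tmapr L k) -> injective (tmapl K i).
Proof.
move=> Pflat kI; apply: additive_inj => t it0.
have [iI _ ip0] := ip; have [_ q_surj kq0] := kq.
(* The chase lifts [t] to [s] over L1 and P, pushes it to F and P, and pulls it back to [r] over F
   and K1, then to [u] over L1 and K1. Flatness of [P] shows that [u] maps to [s], and [t] dies
   because q o k = 0. *)
have [s st] := tensor_surj q_surj t; rewrite -[tensor_map _ _ _]/(tmapr L1 q s) in st.
have [r rs] : exists r, tmapr F k r = tmapl P i s.
  by apply: (tmapr_exact kq); rewrite -tmaplr st.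
have [u ur] : exists u, tmapl K1 i u = r.
  apply: (tmapl_exact ip); apply: (additive_inj0 kI); rewrite -tmaplr rs.
  rewrite [LHS](tensor_map_comp (f'' := \0) (g'' := idfun)) //; last first.
    by move=> n; apply/ip0; exists n.
  by apply: tensor_map_eq0; left.
have us : tmapr L1 k u = s.
  by apply: (flat_tmapl_inj Pflat iI); rewrite tmaplr ur.
rewrite -st -us [LHS](tensor_map_comp (f'' := idfun) (g'' := \0)) //.
  by apply: tensor_map_eq0; right.
by move=> m; apply/kq0; exists m.
Qed.

End Balance.

(** This is [tor1_balance] with the two sequences exchanged, up to flipping the tensor factors. *)
Lemma tor1_balance_sym (L1 F L : lmodType A) (i : {linear L1 -> F})
    (p : {linear F -> L}) (K1 P K : lmodType A) (k : {linear K1 -> P})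
    (q : {linear P -> K}) :
  short_exact i p -> short_exact k q -> flat_module F ->
  injective (tmapl K i) -> injective (tmapr L k).
Proof.
by move=> ip kq Fflat iI; apply: tmapr_inj; apply: (tor1_balance kq ip Fflat); apply: tmapr_inj.
Qed.

(* Both sides are the injectivity of [tensor L1 K -> tensor F P]; that is,     *)
(* Tor_2(L, X) = Tor_1(L1, X) for K the syzygy of X.                           *)
Lemma tor1_shift (L1 F L : lmodType A) (i : {linear L1 -> F})
    (p : {linear F -> L}) (K1 P1 K P X: lmodType A)
    (k1 : {linear K1 -> P1}) (q1 : {linear P1 -> K})
    (k : {linear K -> P}) (q : {linear P -> X}) :
  short_exact i p -> short_exact k1 q1 -> short_exact k q ->
  flat_module F -> flat_module P1 -> flat_module P ->
  injective (tmapr L k1) <-> injective (tmapr L1 k).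
Proof.
move=> ip kq1 kq Fflat P1flat Pflat; have [[iI _ _] [kI _ _]] := (ip, kq).
split=> [k1I|k1I].
  have iKI := tor1_balance ip kq1 P1flat k1I.
  move=> s t /(congr1 (tmapl P i)); rewrite !tmaplr.
  by move=> /(flat_tmapr_inj Fflat kI) /iKI.
apply: (tor1_balance_sym ip kq1 Fflat) => s t /(congr1 (tmapr F k)).
by rewrite -!tmaplr => /(flat_tmapl_inj Pflat iI) /k1I.
Qed.

End AntiInvolution.

(** * Cokernels of linear maps *)

Section Cokernel.
Variables (A : pzRingType) (U V : lmodType A) (j : {linear U -> V}).

Definition lin_im : {pred V} := fun v => `[< exists u, j u = v >].

Fact lin_im_zmod_closed : zmod_closed lin_im.
Proof.
split=> [|x y]; first by apply/asboolP; exists 0; rewrite raddf0.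
move=> /asboolP[u <-] /asboolP[v <-]; apply/asboolP.
by exists (u - v); rewrite raddfB.
Qed.

HB.instance Definition _ := GRing.isZmodClosed.Build V lin_im lin_im_zmod_closed.

Let quotT := {quot (lin_im : zmodClosed V)}.

Definition coker : Type := quotT.
HB.instance Definition _ := GRing.Zmodule.on coker.

Definition coker_pi (v : V) : coker := \pi_quotT v.
Definition coker_repr (x : coker) : V := repr (x : quotT).

Lemma coker_reprK : cancel coker_repr coker_pi.
Proof. exact: reprK. Qed.

Fact coker_pi_is_zmod_morphism : zmod_morphism coker_pi.
Proof. exact: raddfB. Qed.

HB.instance Definition _ :=
  GRing.isZmodMorphism.Build V coker coker_pi coker_pi_is_zmod_morphism.

Lemma coker_pi_eq0 v : coker_pi v = 0 <-> exists u, j u = v.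
Proof.
rewrite -(raddf0 (\pi_quotT : {additive V -> quotT})).
split=> [/eqP|jv].
  by rewrite -[coker_pi v]/(\pi_quotT v) -idealrBE subr0 => /asboolP.
by apply/eqP; rewrite -[coker_pi v]/(\pi_quotT v) -idealrBE subr0; apply/asboolP.
Qed.

Definition coker_scale (a : A) (x : coker) : coker := coker_pi (a *: coker_repr x).

(** Independence of the representative: two of them differ by some [j u], and [a *: j u] is still in
    the image. *)
Lemma coker_scale_pi a v : coker_scale a (coker_pi v) = coker_pi (a *: v).
Proof.
apply/eqP; rewrite -subr_eq0 /coker_scale -raddfB -scalerBr; apply/eqP/coker_pi_eq0.
have [|u ju] := (coker_pi_eq0 (coker_repr (coker_pi v) - v)).1.
  by rewrite raddfB /= coker_reprK subrr.
by exists (a *: u); rewrite linearZ /= ju.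
Qed.

Fact coker_scaleA a b x : coker_scale a (coker_scale b x) = coker_scale (a * b) x.
Proof. by rewrite -[x]coker_reprK !coker_scale_pi scalerA. Qed.

Fact coker_scale1 : left_id 1 coker_scale.
Proof. by move=> x; rewrite -[x]coker_reprK coker_scale_pi scale1r. Qed.

Fact coker_scaleDr : right_distributive coker_scale +%R.
Proof.
move=> a x y; rewrite -[x]coker_reprK -[y]coker_reprK -raddfD !coker_scale_pi.
by rewrite scalerDr raddfD.
Qed.

Fact coker_scaleDl x : {morph coker_scale^~ x : a b / a + b}.
Proof.
by move=> a b; rewrite -[x]coker_reprK !coker_scale_pi scalerDl raddfD.
Qed.

HB.instance Definition _ := GRing.Zmodule_isLmodule.Build A coker
  coker_scaleA coker_scale1 coker_scaleDr coker_scaleDl.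

Fact coker_pi_is_scalable : scalable coker_pi.
Proof. by move=> a v; rewrite -coker_scale_pi. Qed.

HB.instance Definition _ :=
  GRing.isScalable.Build A V coker _ coker_pi coker_pi_is_scalable.

Lemma coker_exact : injective j -> short_exact j coker_pi.
Proof.
move=> jI; split=> // [w|v]; first by exists (coker_repr w); exact: coker_reprK.
exact: coker_pi_eq0.
Qed.

End Cokernel.

(** * Flatness of free modules, and the canonical syzygies *)

Section Free.
Variables (A : pzRingType).

Lemma freemod_ind (K : choiceType) (P : freemod A K -> Prop) :
  P 0 -> (forall x y, P x -> P y -> P (x + y)) ->
  (forall a k, P << a *g k >>) -> forall x, P x.
Proof. by move=> P0 PD PU x; rewrite [x]monalgE; apply: big_ind. Qed.

Lemma fm_scaleU (K : choiceType) (a b : A) (k : K) :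
  a *: (<< b *g k >> : freemod A K) = << a * b *g k >>.
Proof.
by apply/malgP=> k'; rewrite fm_scaleE !mcoeffU mulrnAr.
Qed.

Section TensorCoordinate.
Variables (U : rmodType A) (K : choiceType).

Lemma tens_coord_exists (k : K) :
  {f : {additive tensor U (freemod A K) -> U} |
    forall u g, f (tens u g) = ((g : {malg A[K]})@_k : A^c) *: u}.
Proof.
apply: cid; apply: tensor_univ.
- by move=> u1 u2 g; rewrite scalerDr.
- by move=> u g1 g2; rewrite mcoeffD scalerDl.
by move=> a u g; rewrite fm_scaleE scalerA.
Qed.

Definition tens_coord (k : K) : {additive tensor U (freemod A K) -> U} := sval (tens_coord_exists k).

Lemma tens_coordE k (u : U) (g : freemod A K) :
  tens_coord k (tens u g) = ((g : {malg A[K]})@_k : A^c) *: u.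
Proof. exact: svalP (tens_coord_exists k) u g. Qed.

(** The expansion is asserted on every larger index set so that two tensors can be expanded over a
    common one. *)
Lemma tens_coord_sum (t : tensor U (freemod A K)) :
  exists d : {fset K}, forall d', (d `<=` d')%fset ->
    t = \sum_(k <- d') tens (tens_coord k t) (<< 1 *g k >> : freemod A K).
Proof.
elim/tensor_ind: t => [|s t [ds Hs] [dt Ht]|t [dt Ht]|u g].
- by exists fset0 => d' _; rewrite big1 // => k _; rewrite raddf0 tens0l.
- exists (ds `|` dt)%fset => d' /fsubUsetP[le_s le_t].
  rewrite [s in LHS](Hs d') // [t in LHS](Ht d') // -big_split /=.
  by apply: eq_bigr => k _; rewrite raddfD tensDl.
- exists dt => d' le_t; rewrite [t in LHS](Ht d') // -sumrN.
  by apply: eq_bigr => k _; rewrite raddfN tensNl.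
exists (msupp g) => d' le_g.
have gE : g = \sum_(k <- d') (<< g@_k *g k >> : freemod A K).
  rewrite [LHS]monalgE; apply/big_fset_incl => // k _ /mcoeff_outdom ->.
  exact: monalgU0.
have tens_sum (r : seq K) (F : K -> freemod A K) :
    tens u (\sum_(k <- r) F k) = \sum_(k <- r) tens u (F k).
  by apply: big_morph => [x y|]; rewrite ?tensDr ?tens0r.
rewrite [in LHS]gE tens_sum; apply: eq_bigr => k _.
by rewrite tens_coordE tensZ fm_scaleU mulr1.
Qed.

End TensorCoordinate.

Arguments tens_coord {U K}.

Lemma tens_coord_map (U V : rmodType A) (K : choiceType) (j : {linear U -> V}) k t :
  tens_coord k (tensor_map j (idfun : {linear freemod A K -> freemod A K}) t) =
  j (tens_coord k t).
Proof.
apply: (tensor_ext (f := tens_coord k \o tensor_map j idfun)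
  (g := j \o tens_coord k)) => u g /=.
by rewrite tensor_map_tens !tens_coordE linearZ.
Qed.

(** A tensor with a free module is determined by its coordinates in [U], and these are natural in
    [U]. *)
Lemma freemod_flat (K : choiceType) : flat_module (freemod A K).
Proof.
move=> U V j jI; apply: additive_inj => t jt0.
have [d td] := tens_coord_sum t; rewrite (td d) // big1 // => k _.
suff -> : tens_coord k t = 0 by rewrite tens0l.
by apply: jI; rewrite -tens_coord_map jt0 !raddf0.
Qed.

Lemma flat_retract (M F : lmodType A) (s : {linear M -> F}) (e : {linear F -> M}) :
  cancel s e -> flat_module F -> flat_module M.
Proof.
move=> sK Fflat U V j jI t1 t2 jt12.
have retr (t : tensor U M) : tensor_map idfun e (tensor_map idfun s t) = t.
  by rewrite (tensor_map_comp (f'' := idfun) (g'' := idfun)) // tensor_map_id.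
rewrite -[t1]retr -[t2]retr; congr (tensor_map _ _ _); apply: (Fflat _ _ j jI).
rewrite !(tensor_map_square (f := idfun) (f' := j) (g := s) (g' := idfun)
  (h := j) (h' := idfun) (k := idfun) (k' := s)) //.
by rewrite jt12.
Qed.

Lemma zero_flat (M : lmodType A) : (forall x : M, x = 0) -> flat_module M.
Proof.
move=> M0; apply: (@flat_retract M (freemod A M) \0 \0).
  by move=> x; rewrite [RHS]M0.
exact: freemod_flat.
Qed.

Lemma fm_eval_surj (X : lmodType A) (x : X) : exists g, fm_eval g = x.
Proof. by exists << 1 *g x >>; rewrite /fm_eval malg_liftU /= /scale_fun scale1r. Qed.

Lemma ker_exact (U V : lmodType A) (f : {linear U -> V}) :
  (forall v, exists u, f u = v) -> short_exact (ker_incl f) f.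
Proof.
move=> f_surj; split=> // [|u]; first exact: val_inj.
split=> [fu|[[u' /= fu'] /= <-]]; last by apply/eqP.
have fu' : u \in kerp f by apply/eqP.
by exists (exist _ u fu').
Qed.

Lemma syz_exact (X : lmodType A) (i : nat) :
  short_exact (ker_incl (@fm_eval A (syz X i))) (@fm_eval A (syz X i)).
Proof. exact/ker_exact/fm_eval_surj. Qed.

Lemma syz_add (X : lmodType A) (m j : nat) : syz (syz X m) j = syz X (j + m).
Proof. by elim: j => //= j ->. Qed.

End Free.

(** * Vanishing of Tor in terms of syzygies *)

Section TorCriterion.
Variable A : pzRingType.

Lemma homology_eq0 (U V W : zmodType) (f : {additive U -> V}) (g : {additive V -> W}) :
  (forall t : homology f g, t = 0) <-> (forall y, g y = 0 -> exists x, f x = y).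
Proof.
pose Q := {quot (imp f (g := g) : zmodClosed (kermod g))}.
split=> [H y gy|H t].
  have gy' : y \in kerp g by apply/eqP.
  have /eqP := H (\pi_Q (exist _ y gy')).
  rewrite -(raddf0 (\pi_Q : {additive _ -> Q})) -idealrBE subr0.
  by move=> /asboolP.
rewrite -[t](reprK (t : Q)); apply/eqP.
rewrite -(raddf0 (\pi_Q : {additive _ -> Q})) -idealrBE subr0.
apply/asboolP/H; apply/eqP; exact: (valP (repr (t : Q))).
Qed.

(** After tensoring with [N], the differential F_(j+1) -> F_j factors through the syzygy of index j
    + 1. By right exactness the first factor is onto, with kernel the image of F_(j+2), so the
    homology is the kernel of the second factor. *)
Lemma Tor_eq0 (N : rmodType A) (X : lmodType A) (j : nat) :
  (forall t : Tor j.+1 N X, t = 0) <->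
  injective (tensor_map (idfun : {linear N -> N}) (ker_incl (@fm_eval A (syz X j)))).
Proof.
apply: (iff_trans (homology_eq0 (tor_diff N X j.+1) (tor_diff N X j))).
pose eps := @fm_eval A (syz X j.+1).
have eps_surj := @fm_eval_surj A (syz X j.+1).
have diffE y : tor_diff N X j y = tensor_map (idfun : {linear N -> N})
    (ker_incl (@fm_eval A (syz X j))) (tensor_map idfun eps y).
  by rewrite [RHS](tensor_map_comp (f'' := idfun) (g'' := res_diff X j)).
split=> [H|inj y].
  apply: additive_inj => t it0; have [y yt] := tensor_surj eps_surj t.
  have [|x xy] := H y; first by rewrite diffE yt.
  rewrite -yt -xy [LHS](tensor_map_comp (f'' := idfun) (g'' := \0)) //.
    by apply: tensor_map_eq0; right.
  by move=> m; apply/eqP; apply: (valP (fm_eval m)).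
rewrite diffE => /(additive_inj0 inj).
have [_ _ exX] := syz_exact X j.+1.
apply: (tensor_right_exact eps_surj) => v /exX[k <-].
by have [x <-] := fm_eval_surj k; exists x.
Qed.

End TorCriterion.

(** * Restriction of scalars along mutually inverse morphisms *)

Section RestrictionInverse.
Variables (A B : pzRingType) (f : {rmorphism A -> B}) (g : {rmorphism B -> A}).
Hypothesis gK : cancel g f.

Lemma restr_unit (V : lmodType B) :
  exists h : {linear V -> restr g (restr f V)}, forall v, h v = v.
Proof.
pose h (v : V) : restr g (restr f V) := v.
have h_lin : linear h.
  by move=> b u v; have -> : b *: h u = f (g b) *: u by []; rewrite gK.
by exists (HB.pack_for {linear V -> restr g (restr f V)} h
  (GRing.isLinear.Build _ _ _ _ h h_lin)).
Qed.

Lemma restr_counit (V : lmodType B) :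
  exists h : {linear restr g (restr f V) -> V}, forall v, h v = v.
Proof.
have [h hE] := restr_unit V.
pose k (v : restr g (restr f V)) : V := v.
have k_lin : linear k.
  by move=> b u v; rewrite -[RHS]hE [RHS]linearP !hE.
by exists (HB.pack_for {linear restr g (restr f V) -> V} k
  (GRing.isLinear.Build _ _ _ _ k k_lin)).
Qed.

End RestrictionInverse.

(** An extension problem over [A] becomes one over [B] by restriction along [g]; its solution is
    restricted back along [f]. *)
Lemma restr_injective (A B : pzRingType) (f : {rmorphism A -> B})
    (g : {rmorphism B -> A}) (I : lmodType B) :
  cancel f g -> cancel g f -> injective_module I -> injective_module (restr f I).
Proof.
move=> fK gK inj_I U V j h jI; have [c cE] := restr_counit gK I.
have [u uE] := restr_unit fK V.
have [k kE] := inj_I _ _ (restr_map g j : {linear restr g U -> restr g V})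
  (c \o (restr_map g h : {linear restr g U -> restr g (restr f I)})) jI.
exists ((restr_map f k : {linear restr f (restr g V) -> restr f I}) \o u) => v.
by rewrite /= uE; rewrite [LHS]kE /= cE.
Qed.

Lemma restr_exact (A B : pzRingType) (f : {rmorphism A -> B}) (U V W : lmodType B)
    (i : {linear U -> V}) (p : {linear V -> W}) :
  short_exact i p ->
  short_exact (restr_map f i : {linear restr f U -> restr f V})
              (restr_map f p : {linear restr f V -> restr f W}).
Proof. by []. Qed.

(** * Flat resolutions and vanishing of Tor *)

Section FlatResolutions.
Variable A : pzRingType.

Lemma linear_inverse (U V : lmodType A) (e : {linear U -> V}) :
  injective e -> (forall v, exists u, e u = v) ->
  exists s : {linear V -> U}, cancel s e.
Proof.
move=> eI /choice[s sK].
have s_lin : linear s by move=> a u v; apply: eI; rewrite linearP !sK.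
by exists (HB.pack_for {linear V -> U} s (GRing.isLinear.Build _ _ _ _ s s_lin)).
Qed.

Lemma ker_corestr (U V W : lmodType A) (g : {linear U -> V}) (f : {linear V -> W}) :
  (forall u, f (g u) = 0) ->
  exists h : {linear U -> kermod f}, forall u, ker_incl f (h u) = g u.
Proof.
move=> fg0; have gP u : g u \in kerp f by apply/eqP.
pose h u : kermod f := exist _ (g u) (gP u).
have h_lin : linear h by move=> a u v; apply: val_inj; rewrite /= linearP.
by exists (HB.pack_for {linear U -> kermod f} h
  (GRing.isLinear.Build _ _ _ _ h h_lin)).
Qed.

Lemma flat_resolution0 (L : lmodType A) : flat_module L -> flat_resolution_le L 0.
Proof.
(* The kernel of the identity serves as the zero module in positive degrees. *)
move=> Lflat; pose Z : lmodType A := kermod (idfun : {linear L -> L}).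
have Z0 (z : Z) : z = 0 by apply: val_inj; apply/eqP; exact: (valP z).
exists (fun k => if k is _.+1 then Z else L), (fun k => \0), idfun; split.
- by case=> // k; apply: zero_flat.
- by case=> // k _ x; apply: Z0.
- by move=> m; exists m.
- by move=> x; split=> [/= ->|[y <-]] //; exists 0.
by move=> k x; split=> // _; exists 0; rewrite [x]Z0.
Qed.

(** Splicing: the augmentation onto [K] followed by [i] becomes the lowest differential. *)
Lemma flat_resolution_cons (K F L : lmodType A) (i : {linear K -> F})
    (p : {linear F -> L}) (n : nat) :
  short_exact i p -> flat_module F -> flat_resolution_le K n ->
  flat_resolution_le L n.+1.
Proof.
move=> [iI p_surj ip] Fflat [Fs [d [e [Fs_flat Fs0 e_surj e0 d0]]]].
pose Fs' k := if k is k'.+1 then Fs k' else F.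
pose d' k : {linear Fs' k.+1 -> Fs' k} :=
  match k with 0%N => i \o e | k'.+1 => d k' end.
exists Fs', d', p; split=> //.
- by case.
- by case=> // k; apply: Fs0.
- move=> x; split=> [/ip[y <-]|[y <-]]; last by apply/ip; exists (e y).
  by have [z <-] := e_surj y; exists z.
case=> [|k] x; last exact: d0.
split=> [ex0|[y <-]].
  by apply/e0; apply: iI; rewrite raddf0.
by rewrite /= (e0 _).2 ?raddf0 //; exists y.
Qed.

Lemma flat_resolution_behead (L : lmodType A) (n : nat) :
  flat_resolution_le L n.+1 ->
  exists (K F : lmodType A) (i : {linear K -> F}) (p : {linear F -> L}),
    [/\ short_exact i p, flat_module F & flat_resolution_le K n].
Proof.
move=> [F [d [e [F_flat F0 e_surj e0 d0]]]].
exists (kermod e), (F 0), (ker_incl e), e; split=> //; first exact: ker_exact.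
have [|h hE] := @ker_corestr _ _ _ (d 0) e.
  by move=> u; apply/e0; exists u.
exists (fun k => F k.+1), (fun k => d k.+1), h; split=> //.
- by move=> k lt_nk; apply: F0.
- move=> m; have /e0[x xm] : e (ker_incl e m) = 0 by apply/eqP; exact: (valP m).
  by exists x; apply: val_inj; rewrite -xm -hE.
move=> x; rewrite -d0 -hE; split=> [->|]; first by rewrite raddf0.
by move=> hx; apply: val_inj.
Qed.

(** The term of degree 1 is zero, so the augmentation is an isomorphism from a flat module. *)
Lemma flat_resolution0_flat (L : lmodType A) : flat_resolution_le L 0 -> flat_module L.
Proof.
move=> [F [d [e [F_flat F0 e_surj e0 _]]]].
have [|s sK] := linear_inverse _ e_surj; last exact: (flat_retract sK).
by apply: additive_inj => x /e0[y <-]; rewrite (F0 1 _ y) ?raddf0.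
Qed.

Variable sg : {rmorphism A^c -> A}.
Hypothesis sgK : forall a : A, sg (sg a) = a.

(** Restriction along [sgc] turns right modules into left ones, as restriction along [sg] does the
    converse. *)
Definition sgc (a : A) : A^c := sg a.

Fact sgc_is_zmod_morphism : zmod_morphism sgc.
Proof. by move=> a b; rewrite /sgc (raddfB sg). Qed.

Fact sgc_is_monoid_morphism : monoid_morphism sgc.
Proof. by split=> [|a b]; rewrite /sgc ?(rmorph1 sg) // [LHS](rmorphM sg b a). Qed.

HB.instance Definition _ := GRing.isZmodMorphism.Build A A^c sgc sgc_is_zmod_morphism.
HB.instance Definition _ := GRing.isMonoidMorphism.Build A A^c sgc sgc_is_monoid_morphism.

(** By [Tor_eq0], the index [j] stands for Tor_(j+1), so this is the vanishing of Tor_i(L, X) for i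
    > n, with [L] made a right module through [sg]. *)
Definition tor_vanish (L : lmodType A) (n : nat) : Prop :=
  forall X j, (n <= j)%N -> injective (tmapr sg L (ker_incl (@fm_eval A (syz X j)))).

(** Dimension shifting: Tor_(j+2)(L, X) vanishes exactly when Tor_(j+1)(K, X) does. *)
Lemma tor_vanish_shift (K F L : lmodType A) (i : {linear K -> F})
    (p : {linear F -> L}) (n : nat) :
  short_exact i p -> flat_module F -> tor_vanish L n.+1 <-> tor_vanish K n.
Proof.
move=> ip Fflat.
have shift X j := tor1_shift sgK ip (syz_exact X j.+1) (syz_exact X j) Fflat
  (@freemod_flat A _) (@freemod_flat A _).
split=> [H X j le_nj|H X [//|j] le_nj]; first exact/shift/H.
exact/(shift X j).2/H.
Qed.

(** An injection of right modules, turned into left ones, has a cokernel C. Two uses of balance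
    reduce its injectivity after tensoring with [L] to that of the canonical syzygy inclusion of C,
    where the hypothesis applies with [j] = 0. *)
Lemma tor_vanish0_flat (L : lmodType A) : tor_vanish L 0 -> flat_module L.
Proof.
move=> H U V j jI.
pose jl : {linear restr sgc U -> restr sgc V} := restr_map sgc j.
have jlI : injective (tmapl sg L jl).
  apply: (tmapl_inj sgK).
  apply: (tor1_balance_sym sgK (syz_exact L 0) (coker_exact (j := jl) jI)).
    exact: freemod_flat.
  apply: (tor1_balance sgK _ (syz_exact _ 0)); first exact: syz_exact.
    exact: freemod_flat.
  exact: H.
(* It remains to return from the double restrictions of [U] and [V] to [U] and [V]: the elements are
   the same, but the scalar actions agree only through [sgK]. *)
have sgcK : cancel sg sgc by move=> a; apply: sgK.
have [uU uUE] := restr_unit sgcK U; have [uV uVE] := restr_unit sgcK V.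
have [cU cUE] := restr_counit sgcK U.
have uI : injective (tensor_map uU (idfun : {linear L -> L})).
  apply: (can_inj (g := tensor_map cU idfun)) => t.
  rewrite (tensor_map_comp (f'' := idfun) (g'' := idfun)) ?tensor_map_id // => n.
  by rewrite cUE uUE.
move=> s t /(congr1 (tensor_map uV (idfun : {linear L -> L}))).
rewrite !(tensor_map_square (f := j) (f' := uV) (h := uU)
  (h' := (restr_map sg jl : {linear restr sg (restr sgc U) -> restr sg (restr sgc V)}))
  (g := idfun) (g' := idfun) (k := idfun) (k' := idfun)) //;
  try by move=> n; rewrite uVE uUE.
by move=> /jlI /uI.
Qed.

Lemma flat_resolutionP (L : lmodType A) (n : nat) :
  flat_resolution_le L n <-> tor_vanish L n.
Proof.
elim: n L => [|n IHn] L; split.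
- move=> /flat_resolution0_flat Lflat X j _; apply: (flat_tmapr_inj sgK Lflat).
  exact: val_inj.
- by move=> /tor_vanish0_flat; apply: flat_resolution0.
- move=> /flat_resolution_behead[K [F [i [p [ip Fflat /IHn]]]]].
  exact: (tor_vanish_shift n ip Fflat).2.
move=> /(tor_vanish_shift n (syz_exact L 0) (@freemod_flat A _)).1 /IHn.
by apply: (flat_resolution_cons (syz_exact L 0)); apply: freemod_flat.
Qed.

Lemma tor_vanish_le (L : lmodType A) (m n : nat) :
  (m <= n)%N -> tor_vanish L m -> tor_vanish L n.
Proof. by move=> le_mn H X j le_nj; apply: H; apply: leq_trans le_nj. Qed.

Lemma flat_dim_vanish (L : lmodType A) (n : nat) :
  enat_le (flat_dim L) (EFin n) <-> tor_vanish L n.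
Proof.
rewrite nat_infP; split=> [[m /flat_resolutionP H le_mn]|/flat_resolutionP H].
  exact: tor_vanish_le le_mn H.
by exists n.
Qed.

End FlatResolutions.

(** * The anti-involution of the group ring *)

Section GroupRingInverse.
Variables (R : comPzRingType) (G : groupType).

Definition gr_inv_fun (g : G) (r : R) : grpring R G := << r *g g^-1%g >>.

Fact gr_inv_fun_is_zmod_morphism g : zmod_morphism (gr_inv_fun g).
Proof. by move=> r s; rewrite /gr_inv_fun monalgUB. Qed.

HB.instance Definition _ g := GRing.isZmodMorphism.Build R (grpring R G)
  (gr_inv_fun g) (gr_inv_fun_is_zmod_morphism g).

Definition gr_inv (x : (grpring R G)^c) : grpring R G :=
  malg_lift (fun g => gr_inv_fun g) x.

Fact gr_inv_is_zmod_morphism : zmod_morphism gr_inv.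
Proof. by move=> x y; rewrite /gr_inv raddfB. Qed.

Lemma gr_invU r g : gr_inv (<< r *g g >> : grpring R G) = << r *g g^-1%g >>.
Proof. by rewrite /gr_inv malg_liftU. Qed.

HB.instance Definition _ := GRing.isZmodMorphism.Build (grpring R G)^c (grpring R G)
  gr_inv gr_inv_is_zmod_morphism.

(** Inversion reverses products in [G], and commutativity of [R] restores the order of the
    coefficients. *)
Fact gr_inv_is_monoid_morphism : monoid_morphism gr_inv.
Proof.
split=> [|x y]; first by rewrite [LHS]gr_invU invg1.
rewrite -[x * y]/(gr_mul (y : grpring R G) x) -[RHS]/(gr_mul (gr_inv x) (gr_inv y)).
elim/gr_ind: y => [|y1 y2 H1 H2|a g].
- by rewrite gr_mul0 [gr_inv 0]raddf0 gr_mulr0.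
- by rewrite gr_mulDl !raddfD gr_mulDr /= H1 H2.
elim/gr_ind: x => [|x1 x2 H1 H2|b h].
- by rewrite gr_mulr0 [gr_inv 0]raddf0 gr_mul0.
- by rewrite gr_mulDr !raddfD gr_mulDl /= H1 H2.
by rewrite gr_mulUU !gr_invU gr_mulUU mulrC invgM.
Qed.

HB.instance Definition _ := GRing.isMonoidMorphism.Build (grpring R G)^c (grpring R G)
  gr_inv gr_inv_is_monoid_morphism.

Lemma gr_invK (x : grpring R G) : gr_inv (gr_inv x) = x.
Proof.
elim/gr_ind: x => [|x y Hx Hy|a g]; first by rewrite !raddf0.
  by rewrite !raddfD /= Hx Hy.
by rewrite !gr_invU invgK.
Qed.

End GroupRingInverse.

(** * Syzygies over the group ring, viewed over the coefficient ring *)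

Section ScalarRestriction.
Variables (R : comPzRingType) (G : groupType).
Local Notation RG := (grpring R G).
Local Notation resR M := (restr (@gr_const R G) M).

(** As [R] is commutative, the identity is an anti-involution, and the criterion [flat_dim_vanish]
    applies over [R] too. *)
Definition com_inv (r : R^c) : R := r.

Fact com_inv_is_zmod_morphism : zmod_morphism com_inv.
Proof. by []. Qed.

Fact com_inv_is_monoid_morphism : monoid_morphism com_inv.
Proof. by split=> // r s; rewrite /com_inv [RHS]mulrC. Qed.

HB.instance Definition _ := GRing.isZmodMorphism.Build R^c R com_inv
  com_inv_is_zmod_morphism.
HB.instance Definition _ := GRing.isMonoidMorphism.Build R^c R com_inv
  com_inv_is_monoid_morphism.

(* As an R-module, the free RG-module on K is free on K * G.                   *)
Section Uncurry.
Variable K : choiceType.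

Definition uncurry_fun (k : K) (g : G) (r : R) : freemod R (K * G)%type :=
  << r *g (k, g) >>.

Fact uncurry_fun_is_zmod_morphism k g : zmod_morphism (uncurry_fun k g).
Proof. by move=> r s; rewrite /uncurry_fun monalgUB. Qed.

HB.instance Definition _ k g := GRing.isZmodMorphism.Build R (freemod R (K * G)%type)
  (uncurry_fun k g) (uncurry_fun_is_zmod_morphism k g).

Definition uncurry_row (k : K) : {additive RG -> freemod R (K * G)%type} :=
  malg_lift (fun g => uncurry_fun k g).

Definition fm_uncurry (x : resR (freemod RG K)) : freemod R (K * G)%type :=
  malg_lift uncurry_row x.

Fact fm_uncurry_is_zmod_morphism : zmod_morphism fm_uncurry.
Proof. by move=> x y; rewrite /fm_uncurry raddfB. Qed.

HB.instance Definition _ := GRing.isZmodMorphism.Build (resR (freemod RG K))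
  (freemod R (K * G)%type) fm_uncurry fm_uncurry_is_zmod_morphism.

Definition curry_fun (kg : K * G) (r : R) : resR (freemod RG K) :=
  (<< (<< r *g kg.2 >> : RG) *g kg.1 >> : freemod RG K).

Fact curry_fun_is_zmod_morphism kg : zmod_morphism (curry_fun kg).
Proof. by move=> r s; rewrite /curry_fun !monalgUB. Qed.

HB.instance Definition _ kg := GRing.isZmodMorphism.Build R (resR (freemod RG K))
  (curry_fun kg) (curry_fun_is_zmod_morphism kg).

Definition fm_curry (x : freemod R (K * G)%type) : resR (freemod RG K) :=
  malg_lift (fun kg => curry_fun kg) x.

Fact fm_curry_is_zmod_morphism : zmod_morphism fm_curry.
Proof. by move=> x y; rewrite /fm_curry raddfB. Qed.

HB.instance Definition _ := GRing.isZmodMorphism.Build (freemod R (K * G)%type)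
  (resR (freemod RG K)) fm_curry fm_curry_is_zmod_morphism.

Lemma fm_uncurryU k g r :
  fm_uncurry (<< (<< r *g g >> : RG) *g k >> : freemod RG K) = << r *g (k, g) >>.
Proof. by rewrite /fm_uncurry malg_liftU /= malg_liftU. Qed.

Lemma fm_curryU k g r :
  fm_curry << r *g (k, g) >> = (<< (<< r *g g >> : RG) *g k >> : freemod RG K).
Proof. by rewrite /fm_curry malg_liftU. Qed.

Lemma restr_freemod_ind (P : resR (freemod RG K) -> Prop) :
  P 0 -> (forall x y, P x -> P y -> P (x + y)) ->
  (forall r g k, P (<< (<< r *g g >> : RG) *g k >> : freemod RG K)) -> forall x, P x.
Proof.
move=> P0 PD PU; elim/freemod_ind=> // a k.
elim/gr_ind: a => [|a b Pa Pb|r g]; first by rewrite monalgU0.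
  by rewrite monalgUD; apply: PD.
exact: PU.
Qed.

Lemma fm_uncurryK : cancel fm_uncurry fm_curry.
Proof.
elim/restr_freemod_ind=> [|x y Hx Hy|r g k]; first by rewrite !raddf0.
  by rewrite !raddfD /= Hx Hy.
by rewrite fm_uncurryU fm_curryU.
Qed.

Lemma restr_scaleU (c r : R) g k :
  c *: ((<< (<< r *g g >> : RG) *g k >> : freemod RG K) : resR (freemod RG K)) =
  (<< (<< c * r *g g >> : RG) *g k >> : freemod RG K).
Proof.
rewrite -[LHS]/(gr_const G c *: (<< (<< r *g g >> : RG) *g k >> : freemod RG K)).
by rewrite fm_scaleU -[_ * _]/(gr_mul _ _) gr_mulUU mul1g.
Qed.

Fact fm_uncurry_is_scalable : scalable fm_uncurry.
Proof.
move=> c; elim/restr_freemod_ind=> [|x y Hx Hy|r g k].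
- by rewrite !raddf0.
- by rewrite !raddfD /= Hx Hy.
by rewrite restr_scaleU !fm_uncurryU fm_scaleU.
Qed.

HB.instance Definition _ := GRing.isScalable.Build R (resR (freemod RG K))
  (freemod R (K * G)%type) _ fm_uncurry fm_uncurry_is_scalable.

Fact fm_curry_is_scalable : scalable fm_curry.
Proof.
move=> c; elim/freemod_ind=> [|x y Hx Hy|r [k g]].
- by rewrite !raddf0.
- by rewrite !raddfD /= Hx Hy.
by rewrite fm_scaleU !fm_curryU restr_scaleU.
Qed.

HB.instance Definition _ := GRing.isScalable.Build R (freemod R (K * G)%type)
  (resR (freemod RG K)) _ fm_curry fm_curry_is_scalable.

Lemma restr_freemod_flat : flat_module (resR (freemod RG K)).
Proof. exact: (flat_retract fm_uncurryK (@freemod_flat R _)). Qed.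

End Uncurry.

(** The syzygy sequences stay exact over [R], with flat middle terms by [restr_freemod_flat], so
    each one shifts the degree by one. *)
Lemma restr_syz_vanish (M : lmodType RG) (i n : nat) :
  tor_vanish com_inv (resR M) (i + n) -> tor_vanish com_inv (resR (syz M i)) n.
Proof.
elim: i n => [|i IHi] n; first by rewrite add0n.
rewrite addSnnS => /IHi.
have invK (r : R) : com_inv (com_inv r) = r by [].
have ex := restr_exact (@gr_const R G) (syz_exact M i).
exact: (tor_vanish_shift invK n ex (@restr_freemod_flat _)).1.
Qed.

Lemma restr_syz_flat (M : lmodType RG) (m : nat) :
  enat_le (wgldim R) (EFin m) -> flat_module (resR (syz M m)).
Proof.
move=> /enat_supP wgl; apply: (tor_vanish0_flat (sg := com_inv)) => //.
apply: restr_syz_vanish; rewrite addn0; apply/flat_dim_vanish => //.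
by apply: wgl; exists (resR M).
Qed.

End ScalarRestriction.

(** * The two inequalities *)

Lemma tensor_map_inj_unit (A B : pzRingType) (f : {rmorphism A^c -> B})
    (g : {rmorphism B -> A^c}) (N : rmodType A) (U V : lmodType A) (j : {linear U -> V}) :
  cancel f g ->
  injective (tensor_map (idfun : {linear restr f (restr g N) -> restr f (restr g N)}) j) ->
  injective (tensor_map (idfun : {linear N -> N}) j).
Proof.
move=> fK jI; have [u uE] := restr_unit fK N; have [c cE] := restr_counit fK N.
have uI : injective (tensor_map u (idfun : {linear U -> U})).
  apply: (can_inj (g := tensor_map c idfun)) => t.
  rewrite (tensor_map_comp (f'' := idfun) (g'' := idfun)) ?tensor_map_id // => n.
  by rewrite cE uE.
move=> s t /(congr1 (tensor_map u (idfun : {linear V -> V}))).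
rewrite !(tensor_map_square (f := idfun) (f' := u) (h := u) (h' := idfun)
  (g := j) (g' := idfun) (k := idfun) (k' := j)) //.
by move=> /jI /uI.
Qed.

Lemma ghd_le_sfli (R : comPzRingType) (G : groupType) :
  enat_le (ghd R G) (sfli (grpring R G)).
Proof.
case sfliE: (sfli _) => [n|]; last by case: (ghd _ _).
apply/enat_supP => _ [i [I [M [-> I_inj _ [t t0]]]]].
rewrite /= leqNgt; apply/negP => lt_ni; case: i t t0 lt_ni => // j t /eqP t0.
rewrite ltnS => le_nj; apply: t0; apply: (Tor_eq0 I M j).2 t.
pose sg : {rmorphism (grpring R G)^c -> grpring R G} := @gr_inv R G.
pose sgc : {rmorphism grpring R G -> (grpring R G)^c} := sgc sg.
have sgK : cancel sg sgc by move=> a; apply: gr_invK.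
have sgcK : cancel sgc sg by move=> a; apply: gr_invK.
(* The right module [I] is replaced by the one coming from the left module [restr sgc I], whose flat
   dimension is bounded by [sfli]. *)
apply: (tensor_map_inj_unit (f := sg) (g := sgc) sgK).
have : tor_vanish sg (restr sgc I) n.
  apply/flat_dim_vanish; first exact: gr_invK.
  have : enat_le (sfli (grpring R G)) (EFin n) by rewrite sfliE /=.
  move=> /enat_supP; apply.
  by exists (restr sgc I) => //; apply: restr_injective.
exact.
Qed.

Lemma sfli_le_ghd_wgldim (R : comPzRingType) (G : groupType) :
  enat_le (sfli (grpring R G)) (enat_add (ghd R G) (wgldim R)).
Proof.
case ghdE: (ghd _ _) => [n|]; last by case: (sfli _).
case wglE: (wgldim _) => [m|]; last by case: (sfli _).
apply/enat_supP => _ [I I_inj ->].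
pose sg : {rmorphism (grpring R G)^c -> grpring R G} := @gr_inv R G.
pose sgc : {rmorphism grpring R G -> (grpring R G)^c} := sgc sg.
have sgK : cancel sg sgc by move=> a; apply: gr_invK.
have sgcK : cancel sgc sg by move=> a; apply: gr_invK.
apply/(flat_dim_vanish (sg := sg)); first exact: gr_invK.
(* Since m <= j, the syzygy of index [j] of [X] is that of index [j - m] of [syz X m], a module that
   is flat over [R]. *)
move=> X j le_j; rewrite -(subnK (leq_trans (leq_addl n m) le_j)) -syz_add.
apply: (Tor_eq0 (restr sg I) (syz X m) (j - m)).1 => t.
apply/eqP/negPn/negP => t0.
have : enat_le (EFin (j - m).+1) (EFin n).
  have : enat_le (ghd R G) (EFin n) by rewrite ghdE /=.
  move=> /enat_supP; apply.
  exists (j - m).+1, (restr sg I), (syz X m); split=> //.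
  - exact: restr_injective.
  - by apply: restr_syz_flat; rewrite wglE /=.
  by exists t.
(* From n + m <= j follows n <= j - m, against (j - m) + 1 <= n. *)
by apply/negP; rewrite /= -ltnNge ltnS leq_subRL ?(leq_trans _ le_j) ?leq_addl // addnC.
Qed.

Theorem proposition4p7 (R : comPzRingType) (G : groupType) :
  enat_le (ghd R G) (sfli (grpring R G)) /\
  enat_le (sfli (grpring R G)) (enat_add (ghd R G) (wgldim R)).
Proof. by split; [apply: ghd_le_sfli | apply: sfli_le_ghd_wgldim]. Qed.
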